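(* Let $M$ be a finite commutative monoid with zero $z$ and group of units $G$ such that every element of $M\setminus G$ is nilpotent. Let $m_1=1,m_2,\dots,m_r$ be representatives of the orbits of $G$ on $M\setminus\{z\}$. Let $\chi\in\widehat G$. Then the following hold (notation as in the context). (1) A basis $B_\chi$ for $e_\chi\mathbb C_0M=e_\chi\mathbb C_0Me_\chi$ consists of the elements $$m_{i,\chi}=e_\chi m_i=\frac1{|Gm_i|}\sum_{m\in Gm_i}\overline{\chi(m)}\,m,\qquad i\in J_\chi.$$ (2) $e_\chi\mathbb C_0M\cong\mathbb C_0(M_\chi/G,c_\chi)$, where $c_\chi(Gm_i,Gm_j)=\chi(m_im_j)$ whenever $m_im_j\notin I_\chi\cup\{z\}$. Furthermore, if $m_im_j=m_{f(i,j)}$ whenever $m_im_j\notin I_\chi\cup\{z\}$, then $e_\chi\mathbb C_0M\cong\mathbb C_0[M_\chi/G]$. (3) $\widetilde\theta_{M_\chi/G,c_\chi}=0$ unless $M_\chi/G$ has a unique annihilating element $Gm_{i_\chi}$, in which case $$\widetilde\theta_{M_\chi/G,c_\chi}=\det A(\chi)\cdot x_{Gm_{i_\chi}}^{|M_\chi/G|-1},$$ where $A(\chi)$ is the $J_\chi\times J_\chi$-matrix with $A(\chi)_{ij}=\chi(m_im_j)$ if $m_im_j\in Gm_{i_\chi}$, and $A(\chi)_{ij}=0$ else, for $i,j\in J_\chi$.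
   Context: Nilpotent means that some power equals $z$. $\widehat G$ is the group of characters $\chi\colon G\to\mathbb C^\times$. For a semigroup $T$ with zero $z$, $\mathbb C_0T=\mathbb CT/\mathbb Cz$ is the contracted semigroup algebra, with basis $T\setminus\{z\}$ (also written $\mathbb C_0[T]$). For $\chi\in\widehat G$, $e_\chi=\frac1{|G|}\sum_{g\in G}\overline{\chi(g)}g\in\mathbb CG\subseteq\mathbb C_0M$. $G_i$ is the stabilizer of $m_i$ in $G$, and $J_\chi=\{i\mid G_i\subseteq\ker\chi\}$. When $m_im_j\neq z$, $f(i,j)$ is defined by $m_im_j\in Gm_{f(i,j)}$. $I_\chi$ is the set of $m\in M$ whose stabilizer in $G$ is not contained in $\ker\chi$; it is empty if $\chi$ is the trivial character $1_G$ and otherwise is a proper ideal of $M$ containing $z$. Put $M_\chi=M$ if $\chi=1_G$, and $M_\chi=M/I_\chi$ (Rees quotient, collapsing $I_\chi$ to the zero) otherwise. $M_\chi/G$ is the quotient monoid of $G$-orbits, with product $Gm\cdot Gm'=Gmm'$; its nonzero elements are the $Gm_i$ with $i\in J_\chi$. All its nonidentity elements are nilpotent. For $m\in M\setminus(I_\chi\cup\{z\})$ with $m=gm_i$, $g\in G$, put $\chi(m)=\chi(g)$; this is well defined (given the fixed representatives). If $N$ is a monoid with zero $z$, a twisted contracted monoid algebra $\mathbb C_0(N,c)$ is an associative algebra with basis $N\setminus\{z\}$ and product of $s,t\in N\setminus\{z\}$ equal to $c(s,t)\,st$ if $st\neq z$ in $N$ and $0$ otherwise, with $c(s,t)\in\mathbb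 C^\times$ when $st\ne z$ and $c(1,s)=1=c(s,1)$. Its paratrophic determinant $\widetilde\theta_{N,c}$ is the determinant of the $(N\setminus\{z\})\times(N\setminus\{z\})$ matrix with $(s,t)$-entry $c(s,t)x_{st}$ if $st\neq z$ and $0$ otherwise. If all nonidentity elements of $N$ are nilpotent, an element $m\neq z$ of $N$ is annihilating if $mn=z=nm$ for all nonidentity $n\in N$. *)

(* Defs.v *)
From HB Require Import structures.
From mathcomp Require Import all_boot all_order all_algebra all_fingroup all_field.
From mathcomp Require Import mpoly.
From mathcomp Require Import ring.

Set Implicit Arguments.
Unset Strict Implicit.
Unset Printing Implicit Defensive.

Import GRing.Theory Num.Theory.

Local Open Scope ring_scope.

Reserved Notation "x ** y" (at level 40, left associativity).

(* Only nontrivial monoids with zero are considered, so that contracted algebras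
   are nonzero rings. For the monoid [M] of the theorem nothing is lost: [1] is
   among the representatives of the orbits on [M \ {z}], hence [1 != z]. *)
HB.mixin Record isFinMonoid0 M of Finite M := {
  mmul : M -> M -> M;
  mone : M;
  mzero : M;
  mmulA : associative mmul;
  mmul1 : left_id mone mmul;
  mmulr1 : right_id mone mmul;
  mmul0 : left_zero mzero mmul;
  mmulr0 : right_zero mzero mmul;
  mone_neq0 : mone != mzero
}.

#[short(type="finMonoid0Type")]
HB.structure Definition FinMonoid0 := {M of isFinMonoid0 M & Finite M}.

Notation "x ** y" := (mmul x y).

HB.mixin Record FinMonoid0_isCom M of FinMonoid0 M := {
  mmulC : commutative (@mmul M)
}.

#[short(type="finComMonoid0Type")]
HB.structure Definition FinComMonoid0 :=
  {M of FinMonoid0_isCom M & FinMonoid0 M}.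

Arguments mone {s}.
Arguments mzero {s}.

Definition mpow (M : finMonoid0Type) (x : M) (k : nat) : M :=
  iter k (mmul x) mone.

Definition nilpotent_elt (M : finMonoid0Type) (x : M) :=
  exists k : nat, mpow x k = mzero.

Section Units.
Variable M : finMonoid0Type.

Definition is_munit : pred M :=
  fun g => [exists h : M, (g ** h == mone) && (h ** g == mone)].

Definition munit := {g : M | is_munit g}.

HB.instance Definition _ := Finite.on munit.
HB.instance Definition _ := SubFinite.on munit.

Lemma munitM_subproof (g h : munit) : is_munit (val g ** val h).
Proof.
have /existsP[g' /andP[/eqP gg' /eqP g'g]] := valP g.
have /existsP[h' /andP[/eqP hh' /eqP h'h]] := valP h.
apply/existsP; exists (h' ** g'); apply/andP; split; apply/eqP.
  by rewrite mmulA -[X in X ** _]mmulA hh' mmulr1 gg'.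
by rewrite mmulA -[X in X ** _]mmulA g'g mmulr1 h'h.
Qed.

Lemma munit1_subproof : is_munit mone.
Proof. by apply/existsP; exists mone; rewrite mmul1 eqxx. Qed.

Definition munit_invf (g : munit) : M :=
  odflt mone [pick h : M | (val g ** h == mone) && (h ** val g == mone)].

Lemma munit_invfP g :
  val g ** munit_invf g = mone /\ munit_invf g ** val g = mone.
Proof.
rewrite /munit_invf; case: pickP => [h /andP[/eqP ? /eqP ?] //|no].
by have /existsP[h hP] := valP g; rewrite no in hP.
Qed.

Lemma munitV_subproof (g : munit) : is_munit (munit_invf g).
Proof.
apply/existsP; exists (val g).
by have [-> ->] := munit_invfP g; rewrite eqxx.
Qed.

Definition munit_mul (g h : munit) : munit := Sub _ (munitM_subproof g h).
Definition munit_one : munit := Sub _ munit1_subproof.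
Definition munit_inv (g : munit) : munit := Sub _ (munitV_subproof g).

Fact munit_mulA : associative munit_mul.
Proof. by move=> a b c; apply: val_inj; rewrite /= mmulA. Qed.
Fact munit_mul1 : left_id munit_one munit_mul.
Proof. by move=> a; apply: val_inj; rewrite /= mmul1. Qed.
Fact munit_mulV : left_inverse munit_one munit_inv munit_mul.
Proof.
by move=> a; apply: val_inj => /=; have [_ ->] := munit_invfP a.
Qed.

HB.instance Definition _ :=
  Finite_isGroup.Build munit munit_mulA munit_mul1 munit_mulV.

End Units.

Record unit_hom (gT : finGroupType) (N : finMonoid0Type) := UnitHom {
  uhom :> gT -> N;
  uhom1 : uhom 1%g = mone;
  uhomM : forall g h : gT, uhom (g * h)%g = uhom g ** uhom h
}.

Definition munit_hom (M : finMonoid0Type) : unit_hom (munit M) M :=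
  @UnitHom (munit M) M (fun g : munit M => val g) erefl (fun _ _ => erefl).

Section Action.
Variables (gT : finGroupType) (N : finComMonoid0Type) (phi : unit_hom gT N).

Definition uact_fun (x : N) (g : gT) : N := phi g ** x.

Fact uact_is_action : is_action [set: gT] uact_fun.
Proof.
have actM x g h : uact_fun x (g * h)%g = uact_fun (uact_fun x g) h.
  by rewrite /uact_fun uhomM [phi g ** _]mmulC mmulA.
split=> [g x y|x g h _ _]; last exact: actM.
rewrite /uact_fun => /(congr1 (mmul (phi g^-1%g))).
by rewrite !mmulA -uhomM mulVg uhom1 !mmul1.
Qed.

(* As N is commutative, left translations are a right action in the sense of
   the action library. *)
Canonical uact : {action gT &-> N} := Action uact_is_action.

Definition uorbit (x : N) : {set N} := orbit uact [set: gT] x.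

Lemma uorbitP x y : reflect (exists g, y = phi g ** x) (y \in uorbit x).
Proof.
apply: (iffP imsetP) => [[g _ ->]|[g ->]]; last by exists g; rewrite ?inE.
by exists g.
Qed.

Definition is_uorbit : pred {set N} := fun A => [exists x, A == uorbit x].

(* The quotient monoid N/G, whose elements are the G-orbits on N. The product
   of two orbits is their setwise product, which is the orbit of the product
   (lemma [uorb_mul]). *)
Definition uquo := {A : {set N} | is_uorbit A}.

HB.instance Definition _ := Finite.on uquo.

Fact uorb_subproof x : is_uorbit (uorbit x).
Proof. by apply/existsP; exists x. Qed.

Definition uorb (x : N) : uquo := Sub (uorbit x) (uorb_subproof x).

Lemma uorb_surj (A : uquo) : exists x, A = uorb x.
Proof.
by have /existsP[x /eqP xA] := valP A; exists x; apply: val_inj.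
Qed.

Lemma uorbit_mul x y :
  [set a ** b | a in uorbit x, b in uorbit y] = uorbit (x ** y).
Proof.
apply/setP=> u; apply/imset2P/uorbitP.
  case=> a b /uorbitP[g ->] /uorbitP[h ->] ->; exists (g * h)%g.
  by rewrite uhomM -!mmulA [x ** (_ ** _)]mmulA [x ** _]mmulC -!mmulA.
case=> g ->; exists (phi g ** x) y; last by rewrite mmulA.
  by apply/uorbitP; exists g.
by apply/uorbitP; exists 1%g; rewrite uhom1 mmul1.
Qed.

Fact uquo_mul_subproof (A B : uquo) :
  is_uorbit [set a ** b | a in val A, b in val B].
Proof.
have [x ->] := uorb_surj A; have [y ->] := uorb_surj B.
by rewrite /= uorbit_mul uorb_subproof.
Qed.

Definition uquo_mul (A B : uquo) : uquo := Sub _ (uquo_mul_subproof A B).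

Lemma uquo_mulE x y : uquo_mul (uorb x) (uorb y) = uorb (x ** y).
Proof. by apply: val_inj; rewrite /= uorbit_mul. Qed.

Fact uquo_mulA : associative uquo_mul.
Proof.
move=> A B C; have [x ->] := uorb_surj A; have [y ->] := uorb_surj B.
by have [w ->] := uorb_surj C; rewrite !uquo_mulE mmulA.
Qed.

Fact uquo_mulC : commutative uquo_mul.
Proof.
move=> A B; have [x ->] := uorb_surj A; have [y ->] := uorb_surj B.
by rewrite !uquo_mulE mmulC.
Qed.

Fact uquo_mul1 : left_id (uorb mone) uquo_mul.
Proof. by move=> A; have [x ->] := uorb_surj A; rewrite uquo_mulE mmul1. Qed.

Fact uquo_mulr1 : right_id (uorb mone) uquo_mul.
Proof. by move=> A; rewrite uquo_mulC uquo_mul1. Qed.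

Fact uquo_mul0 : left_zero (uorb mzero) uquo_mul.
Proof. by move=> A; have [x ->] := uorb_surj A; rewrite uquo_mulE mmul0. Qed.

Fact uquo_mulr0 : right_zero (uorb mzero) uquo_mul.
Proof. by move=> A; rewrite uquo_mulC uquo_mul0. Qed.

Fact uquo_one_neq0 : uorb mone != uorb mzero.
Proof.
apply/eqP => /(congr1 val) /= eq10.
have : (mone : N) \in uorbit mone.
  by apply/uorbitP; exists 1%g; rewrite uhom1 mmul1.
rewrite eq10 => /uorbitP[g /eqP].
by rewrite mmulr0 (negPf mone_neq0).
Qed.

HB.instance Definition _ := isFinMonoid0.Build uquo
  uquo_mulA uquo_mul1 uquo_mulr1 uquo_mul0 uquo_mulr0 uquo_one_neq0.
HB.instance Definition _ := FinMonoid0_isCom.Build uquo uquo_mulC.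

Lemma uorb_mul x y : uorb x ** uorb y = uorb (x ** y).
Proof. exact: uquo_mulE. Qed.

End Action.

Section Rees.
Variable M : finComMonoid0Type.

Record proper_ideal := ProperIdeal {
  ideal_set :> {set M};
  ideal0 : mzero \in ideal_set;
  ideal1 : mone \notin ideal_set;
  idealM : forall x y : M, x \in ideal_set -> y ** x \in ideal_set
}.

Variable I : proper_ideal.

(* The Rees quotient M/I, realised on the set (M \ I) U {z}. *)
Definition in_rees : pred M := fun x => (x \notin I) || (x == mzero).

Definition rees := {x : M | in_rees x}.

HB.instance Definition _ := Finite.on rees.

Definition rees_fun (x : M) : M := if x \in I then mzero else x.

Fact rees_subproof x : in_rees (rees_fun x).
Proof. by rewrite /in_rees /rees_fun; case: ifPn => [|->]; rewrite ?eqxx ?orbT. Qed.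

Definition rees_pi (x : M) : rees := Sub (rees_fun x) (rees_subproof x).

Definition rees_mul (x y : rees) : rees := rees_pi (val x ** val y).

Lemma rees_pi_val (x : rees) : rees_pi (val x) = x.
Proof.
apply: val_inj; rewrite /= /rees_fun; case: ifPn => // Ix.
by have := valP x; rewrite /in_rees Ix => /eqP.
Qed.

Lemma rees_pi_eq0 x : (rees_pi x == rees_pi mzero) = (x \in I).
Proof.
rewrite -val_eqE /= /rees_fun ideal0; case: ifPn => [_|]; first exact: eqxx.
by apply: contraNF => /eqP ->; exact: ideal0.
Qed.

Lemma rees_mulE x y : rees_mul (rees_pi x) (rees_pi y) = rees_pi (x ** y).
Proof.
have piI u : u \in I -> rees_pi u = rees_pi mzero.
  by rewrite -rees_pi_eq0 => /eqP.
rewrite /rees_mul /= /rees_fun.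
case: ifPn => [Ix|_]; first by rewrite mmul0 [RHS]piI // mmulC idealM.
by case: ifPn => [Iy|//]; rewrite mmulr0 [RHS]piI // idealM.
Qed.

Fact rees_mulC : commutative rees_mul.
Proof. by move=> x y; rewrite /rees_mul mmulC. Qed.

Fact rees_mulA : associative rees_mul.
Proof.
move=> x y w; rewrite -[x]rees_pi_val -[y]rees_pi_val -[w]rees_pi_val.
by rewrite !rees_mulE mmulA.
Qed.

Fact rees_mul1 : left_id (rees_pi mone) rees_mul.
Proof. by move=> x; rewrite -[x]rees_pi_val rees_mulE mmul1. Qed.

Fact rees_mulr1 : right_id (rees_pi mone) rees_mul.
Proof. by move=> x; rewrite rees_mulC rees_mul1. Qed.

Fact rees_mul0 : left_zero (rees_pi mzero) rees_mul.
Proof. by move=> x; rewrite -[x]rees_pi_val rees_mulE mmul0. Qed.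

Fact rees_mulr0 : right_zero (rees_pi mzero) rees_mul.
Proof. by move=> x; rewrite rees_mulC rees_mul0. Qed.

Fact rees_one_neq0 : rees_pi mone != rees_pi mzero.
Proof. by rewrite rees_pi_eq0 ideal1. Qed.

HB.instance Definition _ := isFinMonoid0.Build rees
  rees_mulA rees_mul1 rees_mulr1 rees_mul0 rees_mulr0 rees_one_neq0.
HB.instance Definition _ := FinMonoid0_isCom.Build rees rees_mulC.

Definition rees_unit_hom (gT : finGroupType) (phi : unit_hom gT M) :
    unit_hom gT rees.
Proof.
exists (fun g => rees_pi (phi g)) => [|g h]; first by rewrite uhom1.
by rewrite uhomM -rees_mulE.
Defined.

End Rees.

Section TwistedAlgebra.
Variables (F : fieldType) (N : finMonoid0Type).

(* The last condition is the associativity of [twmul] below on basis elements. *)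
Definition is_twisting (c : N -> N -> F) : Prop :=
  [/\ forall s t : N, s ** t != mzero -> c s t != 0,
      forall s : N, s != mzero -> c mone s = 1 /\ c s mone = 1
    & forall s t u : N, s ** t ** u != mzero ->
        c s t * c (s ** t) u = c t u * c s (t ** u)].

Record twisting := Twisting {
  twist_fun :> N -> N -> F;
  twistP : is_twisting twist_fun
}.

Fact trivial_is_twisting : is_twisting (fun _ _ => 1).
Proof. by split=> *; rewrite ?oner_neq0. Qed.

Definition trivial_twisting := Twisting trivial_is_twisting.

Definition nonzero := {s : N | s != mzero}.

(* The elements are the coefficient functions on N \ {z}. The argument is not
   used in the carrier: it serves to select the product. *)
Definition twisted_algebra (c : twisting) : Type := {ffun nonzero -> F^o}.

Variable c : twisting.
Local Notation twalg := (twisted_algebra c).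

HB.instance Definition _ := Vector.copy twalg {ffun nonzero -> F^o}.

(* The basis element of [s]; it is 0 if [s] is the zero of [N]. *)
Definition twbas (s : N) : twalg := [ffun t => (val t == s)%:R].

Definition twmul (a b : twalg) : twalg :=
  [ffun u => \sum_s \sum_(t | val s ** val t == val u)
     c (val s) (val t) * a s * b t].

Definition twone : twalg := twbas mone.

Lemma neq0_mull (s t : N) : s ** t != mzero -> s != mzero.
Proof. by apply: contraNN => /eqP ->; rewrite mmul0. Qed.
Lemma neq0_mulr (s t : N) : s ** t != mzero -> t != mzero.
Proof. by apply: contraNN => /eqP ->; rewrite mmulr0. Qed.

Lemma twmulE a b u : twmul a b u =
  \sum_s \sum_t (val s ** val t == val u)%:R * (c (val s) (val t) * a s * b t).
Proof.
rewrite ffunE; apply: eq_bigr => s _; rewrite big_mkcond; apply: eq_bigr => t _.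
by case: ifP; rewrite ?mul1r ?mul0r.
Qed.

Lemma sum_nonzero (n : N) (f : nonzero -> F) (g : N -> F) :
    n != mzero -> (forall t, f t = g (val t)) ->
  \sum_(t : nonzero) (n == val t)%:R * f t = g n.
Proof.
move=> n0 fg; rewrite (bigD1 (Sub n n0 : nonzero)) //= eqxx mul1r fg /=.
rewrite big1 ?addr0 // => t; rewrite -val_eqE /= eq_sym => /negPf ->.
by rewrite mul0r.
Qed.

Fact twmulA : associative twmul.
Proof.
move=> a b d; apply/ffunP => u; rewrite !twmulE.
pose G (s t r : nonzero) : F := \sum_(q : nonzero) (val t ** val r == val q)%:R *
  ((val s ** val q == val u)%:R * (c (val s) (val q) * c (val t) (val r))).
pose H (s t r : nonzero) : F := \sum_(q : nonzero) (val s ** val t == val q)%:R *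
  ((val q ** val r == val u)%:R * (c (val q) (val r) * c (val s) (val t))).
transitivity (\sum_s \sum_t \sum_r G s t r * (a s * b t * d r)).
  apply: eq_bigr => s _.
  under eq_bigr => q _.
    rewrite twmulE !mulr_sumr; under eq_bigr => t _ do rewrite !mulr_sumr.
    over.
  rewrite exchange_big; apply: eq_bigr => t _ /=.
  rewrite exchange_big; apply: eq_bigr => r _ /=.
  by rewrite mulr_suml; apply: eq_bigr => q _; rewrite eq_sym; ring.
transitivity (\sum_s \sum_t \sum_r H s t r * (a s * b t * d r)); last first.
  symmetry; rewrite exchange_big /=.
  transitivity (\sum_r \sum_s \sum_t H s t r * (a s * b t * d r)); last first.
    rewrite exchange_big; apply: eq_bigr => s _ /=; exact: exchange_big.
  apply: eq_bigr => r _.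
  under eq_bigr => q _.
    rewrite twmulE !(mulr_sumr, mulr_suml).
    under eq_bigr => t _ do rewrite !(mulr_sumr, mulr_suml).
    over.
  rewrite exchange_big; apply: eq_bigr => s _ /=.
  rewrite exchange_big; apply: eq_bigr => t _ /=.
  by rewrite mulr_suml; apply: eq_bigr => q _; ring.
apply: eq_bigr => s _; apply: eq_bigr => t _; apply: eq_bigr => r _.
congr (_ * _).
have GE : G s t r = (val s ** val t ** val r == val u)%:R *
    (c (val s) (val t ** val r) * c (val t) (val r)).
  rewrite /G -mmulA; have [tr0|tr0] := eqVneq (val t ** val r) mzero.
    rewrite tr0 mmulr0 eq_sym (negPf (valP u)) mul0r big1 // => q _.
    by rewrite eq_sym (negPf (valP q)) mul0r.
  by rewrite (sum_nonzero (g := fun n => (val s ** n == val u)%:R *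
    (c (val s) n * c (val t) (val r))) tr0).
have HE : H s t r = (val s ** val t ** val r == val u)%:R *
    (c (val s ** val t) (val r) * c (val s) (val t)).
  rewrite /H; have [st0|st0] := eqVneq (val s ** val t) mzero.
    rewrite st0 mmul0 eq_sym (negPf (valP u)) mul0r big1 // => q _.
    by rewrite eq_sym (negPf (valP q)) mul0r.
  by rewrite (sum_nonzero (g := fun n => (n ** val r == val u)%:R *
    (c n (val r) * c (val s) (val t))) st0).
rewrite GE HE; case: eqVneq => [stu|_]; last by rewrite !mul0r.
have [_ _ cA] := twistP c; rewrite !mul1r mulrC -cA ?stu ?(valP u) //.
exact: mulrC.
Qed.

Fact twmul1 : left_id twone twmul.
Proof.
have [_ c1 _] := twistP c; move=> a; apply/ffunP => u; rewrite twmulE.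
rewrite (bigD1 (Sub mone mone_neq0 : nonzero)) //= [X in _ + X]big1 => [|s ne1].
  rewrite addr0 (bigD1 u) //= mmul1 eqxx mul1r (c1 _ (valP u)).1.
  rewrite ffunE eqxx !mul1r big1 ?addr0 // => t; rewrite -val_eqE => /negPf tu.
  by rewrite mmul1 tu mul0r.
rewrite big1 // => t _; rewrite ffunE; move: ne1; rewrite -val_eqE /=.
by move=> /negPf ->; rewrite mulr0 mul0r mulr0.
Qed.

Fact twmulr1 : right_id twone twmul.
Proof.
have [_ c1 _] := twistP c; move=> a; apply/ffunP => u; rewrite twmulE exchange_big.
rewrite (bigD1 (Sub mone mone_neq0 : nonzero)) //= [X in _ + X]big1 => [|s ne1].
  rewrite addr0 (bigD1 u) //= mmulr1 eqxx mul1r (c1 _ (valP u)).2.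
  rewrite ffunE eqxx mul1r mulr1 big1 ?addr0 // => t.
  by rewrite -val_eqE => /negPf tu; rewrite mmulr1 tu mul0r.
rewrite big1 // => t _; rewrite [twone _]ffunE; move: ne1; rewrite -val_eqE /=.
by move=> /negPf ->; rewrite !mulr0.
Qed.

Fact twmulDl : left_distributive twmul +%R.
Proof.
move=> a b d; apply/ffunP => u; rewrite [RHS]ffunE !twmulE -big_split.
apply: eq_bigr => s _; rewrite -big_split; apply: eq_bigr => t _ /=.
by rewrite [(a + b) s]ffunE mulrDr mulrDl mulrDr.
Qed.

Fact twmulDr : right_distributive twmul +%R.
Proof.
move=> a b d; apply/ffunP => u; rewrite [RHS]ffunE !twmulE -big_split.
apply: eq_bigr => s _; rewrite -big_split; apply: eq_bigr => t _ /=.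
by rewrite [(b + d) t]ffunE !mulrDr.
Qed.

Fact twone_neq0 : twone != 0.
Proof.
apply/eqP => /ffunP /(_ (Sub mone mone_neq0)); rewrite !ffunE /= eqxx.
by move/eqP; rewrite oner_eq0.
Qed.

HB.instance Definition _ := GRing.Zmodule_isNzRing.Build twalg
  twmulA twmul1 twmulr1 twmulDl twmulDr twone_neq0.

Lemma twmul_def (a b : twalg) : a * b = twmul a b.
Proof. by []. Qed.

Lemma twscaleE (k : F) (a : twalg) u : (k *: a) u = k * a u.
Proof. by rewrite ffunE. Qed.

Fact twscalerAl (k : F) (a b : twalg) : k *: (a * b) = (k *: a) * b.
Proof.
apply/ffunP => u; rewrite !twmul_def twscaleE !twmulE mulr_sumr.
apply: eq_bigr => s _; rewrite mulr_sumr; apply: eq_bigr => t _ /=.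
by rewrite twscaleE; ring.
Qed.

HB.instance Definition _ := GRing.Lmodule_isLalgebra.Build F twalg twscalerAl.

Fact twscalerAr (k : F) (a b : twalg) : k *: (a * b) = a * (k *: b).
Proof.
apply/ffunP => u; rewrite !twmul_def twscaleE !twmulE mulr_sumr.
apply: eq_bigr => s _; rewrite mulr_sumr; apply: eq_bigr => t _ /=.
by rewrite twscaleE; ring.
Qed.

HB.instance Definition _ := GRing.Lalgebra_isAlgebra.Build F twalg twscalerAr.
HB.instance Definition _ := Algebra_isFalgebra.Build F twalg.

Lemma twbas0 : twbas mzero = 0.
Proof. by apply/ffunP => u; rewrite !ffunE (negPf (valP u)). Qed.

Lemma twbas_mul (s t : N) : s != mzero -> t != mzero ->
  twbas s * twbas t = if s ** t == mzero then 0 else c s t *: twbas (s ** t).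
Proof.
move=> s0 t0; apply/ffunP => u; rewrite twmul_def twmulE.
rewrite (bigD1 (Sub s s0 : nonzero)) //= [X in _ + X]big1 => [|v ne]; last first.
  rewrite big1 // => w _; rewrite [twbas s _]ffunE; move: ne.
  by rewrite -val_eqE /= => /negPf ->; rewrite mulr0 mul0r mulr0.
rewrite addr0 (bigD1 (Sub t t0 : nonzero)) //= [X in _ + X]big1 => [|v ne]; last first.
  rewrite [twbas t _]ffunE; move: ne.
  by rewrite -val_eqE /= => /negPf ->; rewrite !mulr0.
rewrite addr0 [twbas s _]ffunE [twbas t _]ffunE /= !eqxx !mulr1.
have [st0|st0] := eqVneq (s ** t) mzero.
  by rewrite [RHS]ffunE st0 eq_sym (negPf (valP u)) mul0r.
by rewrite twscaleE ffunE eq_sym mulrC.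
Qed.

End TwistedAlgebra.

(* U is the image in A of an injective linear multiplicative map from B that
   sends 1 to e; that is, the corner U of A, with identity e, is isomorphic to
   the algebra B. *)
Definition corner_iso (F : fieldType) (A : falgType F) (e : A) (U : {vspace A})
    (B : falgType F) : Prop :=
  exists f : 'Hom(B, A),
    [/\ lker f = 0%VS, limg f = U, f 1 = e & {morph f : x y / x * y}].

Section Paratrophic.
Variables (F : fieldType) (N : finMonoid0Type).

(* The variable x_s attached to s != z; variables are numbered along [enum]. *)
Definition pvar (s : N) : {mpoly F[#|{: nonzero N}|]} :=
  if insub s is Some u then 'X_(enum_rank (u : nonzero N)) else 0.

Definition paratrophic_entry (c : N -> N -> F) (s t : N) :
    {mpoly F[#|{: nonzero N}|]} :=
  if s ** t == mzero then 0 else c s t *: pvar (s ** t).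

Definition paratrophic_det (c : N -> N -> F) : {mpoly F[#|{: nonzero N}|]} :=
  \det (\matrix_(i, j < #|{: nonzero N}|)
    paratrophic_entry c (val (enum_val i)) (val (enum_val j))).

Definition annihilating (s : N) : Prop :=
  s != mzero /\ forall n : N, n != mone -> s ** n = mzero /\ n ** s = mzero.

End Paratrophic.

(* Multiplicative characters with values in the nonzero elements of a field:
   [char_val1] and [char_valM] force the values to be nonzero. *)
Record mcharacter (gT : finGroupType) (F : fieldType) := MCharacter {
  char_val :> gT -> F;
  char_val1 : char_val 1%g = 1;
  char_valM : forall g h : gT, char_val (g * h)%g = char_val g * char_val h
}.

Section Components.
Variables (F : numClosedFieldType) (M : finComMonoid0Type).
Local Notation G := (munit M).

Definition Gorbit (x : M) : {set M} := uorbit (munit_hom M) x.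

Definition Gstab (x : M) : {set G} := 'C[x | uact (munit_hom M)]%g.

Definition contracted := twisted_algebra (trivial_twisting F M).

Definition cbas (x : M) : contracted := twbas _ x.

Variable chi : mcharacter G F.

Definition char_ker : {set G} := [set g | chi g == 1].

Definition e_ : contracted :=
  #|{: G}|%:R^-1 *: \sum_(g : G) (chi g)^* *: cbas (val g).

(* I_chi, and I_chi U {z}. The latter is I_chi itself unless chi is trivial. *)
Definition Ichi : {set M} := [set x | ~~ (Gstab x \subset char_ker)].

Definition zIchi : {set M} := mzero |: Ichi.

Lemma GstabP (x : M) (g : G) : reflect (val g ** x = x) (g \in Gstab x).
Proof. by apply: (iffP astab1P). Qed.

Fact zIchi0 : mzero \in zIchi.
Proof. exact: setU11. Qed.

Fact zIchi1 : mone \notin zIchi.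
Proof.
rewrite !inE negb_or mone_neq0 negbK /=; apply/subsetP => g /GstabP.
rewrite mmulr1 => g1; rewrite inE; suff -> : g = 1%g by rewrite char_val1 eqxx.
exact: val_inj.
Qed.

Fact zIchiM (x y : M) : x \in zIchi -> y ** x \in zIchi.
Proof.
case/setU1P => [->|]; first by rewrite mmulr0 zIchi0.
rewrite 2!inE => Ix; rewrite inE orbC inE; apply/orP; left.
apply: contra Ix => /subsetP sub; apply/subsetP => g /GstabP gx; apply: sub.
by apply/GstabP; rewrite mmulA [_ ** y]mmulC -mmulA gx.
Qed.

Definition Ichi_ideal : proper_ideal M := ProperIdeal zIchi0 zIchi1 zIchiM.

(* M_chi. For trivial chi this is M / {z}, in which nothing is collapsed, in
   place of M itself. *)
Definition Mchi := rees Ichi_ideal.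

(* M_chi / G, the quotient by the action of G through M -> M_chi. *)
Definition MchiG := uquo (rees_unit_hom Ichi_ideal (munit_hom M)).

(* The orbit of the image of x in M_chi; it is the zero of M_chi / G if x is in
   I_chi U {z}. *)
Definition Gorb (x : M) : MchiG := uorb _ (rees_pi Ichi_ideal x).

Variables (r : nat) (m : 'I_r.+1 -> M).

Definition orbit_reps : Prop :=
  [/\ m ord0 = mone,
      forall i, m i != mzero
    & forall x : M, x != mzero -> exists! i, x \in Gorbit (m i)].

Definition Jchi : {set 'I_r.+1} := [set i | Gstab (m i) \subset char_ker].

(* f(i, j); only meaningful if m_i m_j != z. *)
Definition fidx (i j : 'I_r.+1) : 'I_r.+1 :=
  odflt ord0 [pick k | m i ** m j \in Gorbit (m k)].

(* chi(x) for x not in I_chi U {z}, see [chi_extE]. *)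
Definition chi_ext (x : M) : F :=
  if [pick p : G * 'I_r.+1 | x == val p.1 ** m p.2] is Some p
  then chi p.1 else 0.

Lemma chi_extE (g : G) (i : 'I_r.+1) :
  orbit_reps -> val g ** m i \notin zIchi -> chi_ext (val g ** m i) = chi g.
Proof.
move=> [_ m0 mU] nI; rewrite /chi_ext; case: pickP => [[h j] /= /eqP ghE|]; last first.
  by move/(_ (g, i)); rewrite eqxx.
have gm0 : val g ** m i != mzero.
  by move: nI; rewrite inE negb_or inE => /andP[].
have [k [_ kU]] := mU _ gm0.
have ki : k = i by apply: kU; apply/uorbitP; exists g.
have kj : k = j by apply: kU; apply/uorbitP; exists h.
move: ghE; rewrite -kj ki => ghE.
have mi_nI : m i \notin zIchi by apply: contra nI; exact: zIchiM.
have /subsetP sub : Gstab (m i) \subset char_ker.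
  by move: mi_nI; rewrite inE negb_or => /andP[_]; rewrite inE negbK.
have : (h^-1 * g)%g \in char_ker.
  apply/sub/GstabP; rewrite [val _]/(val (h^-1)%g ** val g) -mmulA ghE mmulA.
  by rewrite -[_ ** val h]/(val (h^-1 * h)%g) mulVg mmul1.
rewrite inE => /eqP hg1; rewrite -[g](mulKVg h) char_valM hg1 mulr1 //.
Qed.

(* c_chi(Gm_i, Gm_j) = chi(m_i m_j); only meaningful if m_i m_j is not in
   I_chi U {z}. *)
Definition cchi (s t : MchiG) : F :=
  if [pick p : 'I_r.+1 * 'I_r.+1 |
       [&& p.1 \in Jchi, p.2 \in Jchi, s == Gorb (m p.1) & t == Gorb (m p.2)]]
  is Some p then chi_ext (m p.1 ** m p.2) else 0.

(* The J_chi x J_chi matrix A(chi), with Gm_k the annihilating orbit. *)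
Definition Achi (k : 'I_r.+1) : 'M[F]_#|Jchi| :=
  \matrix_(a, b < #|Jchi|)
    let x := m (enum_val a) ** m (enum_val b) in
    if x \in Gorbit (m k) then chi_ext x else 0.

End Components.

(* Main.v *)
(* Writing chi(x) for the value of chi on x = g m_i, one has e x = chi(x) e m_i
   for x outside I_chi U {z}, and e x = 0 on I_chi U {z} because a stabilizing
   g with chi(g) != 1 gives e x = e g x = chi(g) e x. So the e m_i, i in J_chi,
   span the component and multiply with structure constants
   c_chi = chi(xy) / (chi(x) chi(y)), which is a cocycle.

   For (3), let N be a finite monoid with zero with nilpotent nonidentity
   elements and let a be annihilating. The Gram matrices of the bilinear forms
   (v, w) |-> la(vw) and (v, w) |-> mu(vw) for linear forms la, mu are related by
   right multiplication by the element u with la(v u) = mu(v) for all v, when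
   there is one. That multiplication is triangular for the divisibility order,
   with constant diagonal the coefficient u_1 = mu(a) / la(a).
   Clearing denominators and using this in both directions for the generic form
   and the coefficient form of a gives det = det A x_a^n for every annihilating a. If there is a second
   annihilating element b, then the row of b in A vanishes. *)
Require Import Defs.
From HB Require Import structures.
From mathcomp Require Import all_boot all_order all_algebra all_fingroup all_field.
From mathcomp Require Import reals complex.
From mathcomp Require Import mpoly.
From mathcomp Require Import ring.

Set Implicit Arguments.
Unset Strict Implicit.
Unset Printing Implicit Defensive.

Import GRing.Theory Num.Theory.

Local Open Scope ring_scope.

(** The row and column permutations agree, so their signs cancel. Later this matches matrices
    indexed by [Jchi] with those indexed by nonzero orbits. *)
Lemma det_mxsub_bij (R : comNzRingType) (p n : nat) (h : 'I_p -> 'I_n)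
    (A : 'M[R]_n) :
  bijective h -> \det (mxsub h h A) = \det A.
Proof.
move=> hbij.
have pn : p = n by rewrite -(card_ord p) -(card_ord n) (bij_eq_card hbij).
subst p; pose s := perm (bij_inj hbij).
have -> : mxsub h h A = row_perm s (col_perm s A).
  by apply/matrixP => i j; rewrite !mxE !permE.
rewrite row_permE col_permE !det_mulmx !det_perm mulrCA -signr_addb.
by rewrite odd_permV addbb mulr1.
Qed.

(** * Bilinear forms over a monoid with nilpotent nonidentity elements *)

Section NilpotentMonoid.
Variable N : finMonoid0Type.
Hypothesis nilN : forall x : N, x != mone -> nilpotent_elt x.

Lemma mmul_mpow_fix (t x : N) k : t ** x = t -> t ** mpow x k = t.
Proof.
by move=> tx; elim: k => [|k IHk]; rewrite ?mmulr1 //= mmulA tx.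
Qed.

(** Every power of [x] also fixes [t], and a nonidentity [x] has a zero power. *)
Lemma mmul_fix_eq1 (t x : N) : t != mzero -> t ** x = t -> x = mone.
Proof.
move=> t0 tx; apply/eqP; apply: contraNT t0 => /nilN[k xk0].
by rewrite -(mmul_mpow_fix k tx) xk0 mmulr0.
Qed.

(** A nonidentity [t] has a vanishing power, and left multiplication by [s] lowers its exponent,
    down to [mone = mzero]. *)
Lemma mmul_eq1 (s t : N) : s ** t = mone -> s = mone.
Proof.
move=> st; suff t1 : t = mone by rewrite -st t1 mmulr1.
apply/eqP; apply/negPn/negP => /nilN[k tk0].
suff : (mone : N) = mzero by apply/eqP; exact: mone_neq0.
elim: k tk0 => [//|k IHk] /= tk0; apply: IHk.
by rewrite -[LHS]mmul1 -st -mmulA [X in _ ** X]tk0 mmulr0.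
Qed.

(** A numerical rank for the divisibility order. *)
Definition depth (t : N) : nat := #|[set d | [exists s, d ** s == t]]|.

(** [t ** s] divides itself but not [t]: [t ** (s ** u) = t] would give [s ** u = mone], hence
    [s = mone]. *)
Lemma ltn_depth (t s : N) : t ** s != mzero -> s != mone ->
  (depth t < depth (t ** s))%N.
Proof.
move=> ts0 s1; apply/proper_card/properP; split.
  apply/subsetP => d; rewrite !inE => /existsP[u /eqP <-].
  by apply/existsP; exists (u ** s); rewrite mmulA.
exists (t ** s); first by rewrite inE; apply/existsP; exists mone; rewrite mmulr1.
rewrite inE; apply: contra s1 => /existsP[u]; rewrite -mmulA => /eqP tsu.
by rewrite (mmul_eq1 (mmul_fix_eq1 (neq0_mull ts0) tsu)).
Qed.

Section TwistedForms.
Variables (R : comNzRingType) (c : N -> N -> R).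
Hypothesis c1 : forall s : N, s != mzero -> c mone s = 1 /\ c s mone = 1.
Hypothesis cA : forall s t u : N, s ** t ** u != mzero ->
  c s t * c (s ** t) u = c t u * c s (t ** u).

Local Notation n := #|{: nonzero N}|.

Definition nzval (i : 'I_n) : N := val (enum_val i : nonzero N).

Lemma nzval_neq0 i : nzval i != mzero.
Proof. exact: valP (enum_val i : nonzero N). Qed.

Lemma nzval_inj : injective nzval.
Proof. by move=> i j /val_inj/enum_val_inj. Qed.

Lemma nzval_surj s : s != mzero -> exists i, nzval i = s.
Proof.
by move=> s0; exists (enum_rank (Sub s s0 : nonzero N)); rewrite /nzval enum_rankK.
Qed.

(* The Gram matrix of the bilinear form (v, w) |-> la (v w) of the twisted
   algebra, for a linear form la. *)
Definition form_mx (la : N -> R) : 'M[R]_n :=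
  \matrix_(i, j) if nzval i ** nzval j == mzero then 0
                 else c (nzval i) (nzval j) * la (nzval i ** nzval j).

(* Right multiplication by u in the twisted algebra, the columns being the images
   of the basis elements. *)
Definition mulr_mx (u : 'cV[R]_n) : 'M[R]_n :=
  \matrix_(i, j) \sum_(k | nzval j ** nzval k == nzval i)
    c (nzval j) (nzval k) * u k 0.

(** The hypothesis says la(v u) = d mu(v) for all v; by associativity la(v (w u)) = la((v w) u) = d
    mu(v w). *)
Lemma form_mulr_mx (la mu : N -> R) (d : R) (u : 'cV[R]_n) :
    form_mx la *m u = d *: (\col_i mu (nzval i)) ->
  form_mx la *m mulr_mx u = d *: form_mx mu.
Proof.
move=> /matrixP la_u; apply/matrixP => i j; rewrite !mxE.
under eq_bigr => l _ do rewrite [mulr_mx u l j]mxE mulr_sumr.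
rewrite (exchange_big_dep xpredT) //=.
have inner k : \sum_(l | nzval j ** nzval k == nzval l)
      form_mx la i l * (c (nzval j) (nzval k) * u k 0) =
    if nzval i ** nzval j ** nzval k == mzero then 0
    else c (nzval i) (nzval j) * c (nzval i ** nzval j) (nzval k)
         * la (nzval i ** nzval j ** nzval k) * u k 0.
  have [jk0|jk0] := eqVneq (nzval j ** nzval k) mzero.
    rewrite -mmulA jk0 mmulr0 eqxx big1 // => l.
    by rewrite eq_sym (negPf (nzval_neq0 l)).
  have [l lE] := nzval_surj jk0; rewrite (big_pred1 l) => [|l']; last first.
    by rewrite -lE (inj_eq nzval_inj) eq_sym.
  rewrite mxE lE -mmulA; case: eqP => [_|/eqP ijk0]; first by rewrite mul0r.
  by rewrite cA -?mmulA //; ring.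
under eq_bigr => k _ do rewrite inner.
have [ij0|ij0] := eqVneq (nzval i ** nzval j) mzero.
  by rewrite mulr0 big1 // => k _; rewrite ij0 mmul0 eqxx.
have [l lE] := nzval_surj ij0; have := la_u l 0; rewrite !mxE lE => laE.
rewrite mulrCA -laE mulr_sumr; apply: eq_bigr => k _.
by rewrite mxE lE; case: ifP => _; rewrite ?mul0r ?mulr0 // !mulrA.
Qed.

(** A nonzero off-diagonal entry has strictly greater [depth] at its row than at its column, so only
    the identity permutation contributes. *)
Lemma det_mulr_mx (u : 'cV[R]_n) (k1 : 'I_n) :
  nzval k1 = mone -> \det (mulr_mx u) = u k1 0 ^+ n.
Proof.
move=> k1E.
have supp i j : mulr_mx u i j != 0 ->
    (i == j) || (depth (nzval j) < depth (nzval i))%N.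
  rewrite mxE => ne0; apply/orP.
  have [k /eqP jk] : exists k, nzval j ** nzval k == nzval i.
    apply/existsP; apply: contraNT ne0; rewrite negb_exists => /forallP no.
    by rewrite big1 // => k; rewrite (negPf (no k)).
  have [k_1|k_1] := eqVneq (nzval k) mone.
    by left; apply/eqP/nzval_inj; rewrite -jk k_1 mmulr1.
  by right; rewrite -jk ltn_depth // jk nzval_neq0.
rewrite /determinant (bigD1 1%g) //= [X in _ + X]big1 => [|s s1]; last first.
  have [/existsP[i /eqP i0]|] := boolP [exists i, mulr_mx u i (s i) == 0].
    by rewrite (bigD1 i) //= i0 mul0r mulr0.
  rewrite negb_exists => /forallP ne0; case/eqP: s1; apply/permP => i.
  have le_s j : (depth (nzval (s j)) <= depth (nzval j))%N.
    by case/orP: (supp _ _ (ne0 j)) => [/eqP <-|/ltnW].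
  rewrite perm1; case/orP: (supp _ _ (ne0 i)) => [/eqP <- //|lti].
  (* [s] never raises [depth] and lowers it at [i], yet it only permutes the terms of the total. *)
  have : (\sum_j depth (nzval (s j)) < \sum_j depth (nzval j))%N.
    by rewrite (bigD1 i) //= [X in (_ < X)%N](bigD1 i) //= -addSn leq_add // leq_sum.
  by rewrite [X in (_ < X)%N](reindex_inj (@perm_inj _ s)) ltnn.
rewrite odd_perm1 expr0 mul1r addr0.
(* On the diagonal [t ** x = t] forces [x = mone], leaving only the term at [k1]. *)
under eq_bigr => i _.
  rewrite perm1 mxE (big_pred1 k1) => [|k].
    rewrite k1E (c1 (nzval_neq0 i)).2 mul1r; over.
  rewrite /=; apply/eqP/eqP => [/mmul_fix_eq1 k_1|->]; last by rewrite k1E mmulr1.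
  by apply: nzval_inj; rewrite k1E k_1 // nzval_neq0.
by rewrite prodr_const card_ord.
Qed.

(* Cramer's rule solves la (v u) = D mu v for u, with D the determinant of the
   form of la, and u_1 la a = D mu a as a is annihilating. *)
Lemma det_form_mx_exchange (la mu : N -> R) (a : N) : annihilating a ->
  \det (form_mx la) ^+ n.+1 * mu a ^+ n =
  \det (form_mx la) ^+ n * \det (form_mx mu) * la a ^+ n.
Proof.
move=> [a0 aN]; have [k1 k1E] := nzval_surj mone_neq0.
have [ka kaE] := nzval_surj a0.
pose v : 'cV[R]_n := \col_i mu (nzval i).
pose u := \adj (form_mx la) *m v.
have la_u : form_mx la *m u = \det (form_mx la) *: v.
  by rewrite mulmxA mul_mx_adj mul_scalar_mx.
clearbody u; have u1E : la a * u k1 0 = \det (form_mx la) * mu a.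
  have /matrixP/(_ ka 0) := la_u; rewrite !mxE kaE => <-.
  rewrite (bigD1 k1) //= [X in _ + X]big1 => [|k ne].
    by rewrite addr0 [form_mx _ _ _]mxE kaE k1E mmulr1 (negPf a0) (c1 a0).2 mul1r.
  rewrite mxE kaE (aN (nzval k) _).1 ?eqxx ?mul0r //.
  by apply: contraNneq ne => k_1; apply/eqP/nzval_inj; rewrite k1E.
(* This gives D u_1^n = D^n det(mu), D being the determinant for [la]; the factor la(a)^n then
   brings in [u1E]. *)
have := congr1 determinant (form_mulr_mx la_u).
rewrite det_mulmx detZ (det_mulr_mx u k1E) => detE.
by rewrite exprS -mulrA -exprMn -u1E exprMn mulrCA [LHS]mulrC detE.
Qed.

End TwistedForms.

(** With D for [la] and d for the coefficient form of [a], one exchange gives D^(n+1) = D^n d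
    la(a)^n, enough if D is nonzero; if D = 0, the reverse exchange gives d^(n+1) la(a)^n = 0. *)
Lemma det_form_mx (R : idomainType) (c : N -> N -> R) (la : N -> R) (a : N) :
    (forall s : N, s != mzero -> c mone s = 1 /\ c s mone = 1) ->
    (forall s t u : N, s ** t ** u != mzero ->
      c s t * c (s ** t) u = c t u * c s (t ** u)) ->
    annihilating a ->
  \det (form_mx c la) =
  \det (form_mx c (fun s => (s == a)%:R)) * la a ^+ #|{: nonzero N}|.
Proof.
move=> c1 cA aN.
have := det_form_mx_exchange c1 cA la (fun s => (s == a)%:R) aN.
have := det_form_mx_exchange c1 cA (fun s => (s == a)%:R) la aN.
rewrite eqxx expr1n !mulr1; set D := \det (form_mx c la); set d := \det _.
have [-> /eqP|D0 _] := eqVneq D 0.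
  by rewrite mulr0 mulf_eq0 expf_eq0 /= => /orP[]/eqP -> _; rewrite ?mul0r ?mulr0.
by rewrite exprSr -mulrA => /(mulfI (expf_neq0 _ D0)).
Qed.

(** In the row of [b] only the column of [mone] has a nonzero product, namely [b], whose coefficient
    at [a] is 0. *)
Lemma det_form_mx_eq0 (R : comNzRingType) (c : N -> N -> R) (a b : N) :
    annihilating b -> a != mzero -> a != b ->
  \det (form_mx c (fun s => (s == a)%:R)) = 0.
Proof.
move=> [b0 bN] a0 ab; have [k kE] := nzval_surj b0.
rewrite (expand_det_row _ k) big1 // => j _; rewrite mxE kE.
have [-> |j1] := eqVneq (nzval j) mone; last by rewrite (bN _ j1).1 eqxx mul0r.
by rewrite mmulr1 (negPf b0) eq_sym (negPf ab) mulr0 mul0r.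
Qed.

(** The paratrophic matrix is the Gram matrix of the generic form [pvar] over a polynomial ring,
    which is a domain. *)
Lemma paratrophic_detE (F : fieldType) (c : twisting F N) (a : N) :
    annihilating a ->
  paratrophic_det c = (\det (form_mx c (fun s => (s == a)%:R)))%:MP *
    pvar F a ^+ #|{: nonzero N}|.
Proof.
move=> aN; have [_ c1 cA] := twistP c.
have -> : paratrophic_det c = \det (form_mx (fun s t => (c s t)%:MP) (@pvar F N)).
  congr determinant; apply/matrixP => i j; rewrite !mxE /paratrophic_entry.
  by case: ifP => // _; rewrite mul_mpolyC.
rewrite (det_form_mx _ _ _ aN) => [|s s0|s t u stu0]; last 2 first.
- by rewrite (c1 s s0).1 (c1 s s0).2.
- by rewrite -!mpolyCM cA.
congr (_ * _); rewrite -det_map_mx; congr determinant.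
apply/matrixP => i j; rewrite !mxE; case: ifP => _; first by rewrite rmorph0.
by rewrite rmorphM rmorph_nat.
Qed.

End NilpotentMonoid.

(** A nonzero element of maximal [depth] works, as [ltn_depth] forbids nonzero products with
    nonidentity elements. *)
Lemma ex_annihilating (N : finComMonoid0Type) :
    (forall x : N, x != mone -> nilpotent_elt x) ->
  exists a : N, annihilating a.
Proof.
move=> nilN.
have [a a0 amax] := @arg_maxnP N mone (fun s => s != mzero) (@depth N) mone_neq0.
have aN n : n != mone -> a ** n = mzero.
  move=> n1; apply/eqP; apply: contraT => an0.
  by have := amax _ an0; rewrite /geq /= leqNgt ltn_depth.
by exists a; split=> // n n1; split; last rewrite mmulC; exact: aN.
Qed.

Lemma paratrophic_det_eq0 (F : fieldType) (N : finComMonoid0Type)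
    (c : twisting F N) :
    (forall x : N, x != mone -> nilpotent_elt x) ->
    ~ (exists! a : N, annihilating a) ->
  paratrophic_det c = 0.
Proof.
move=> nilN noU; have [a aN] := ex_annihilating nilN.
(* An annihilating element exists, so non-uniqueness must come from a second one; the boolean search
   makes this case split decidable. *)
have [/existsP[b /and3P[ba b0 /forall_inP bN]]|no] := boolP [exists b : N,
    [&& b != a, b != mzero & [forall (n | n != mone), b ** n == mzero]]].
  have {b0}bN : annihilating b.
    by split=> // n n1; split; last rewrite mmulC; apply/eqP/bN.
  have [a0 _] := aN.
  rewrite (paratrophic_detE _ _ aN) // (det_form_mx_eq0 _ bN) //.
    by rewrite mpolyC0 mul0r.
  by rewrite eq_sym.
case: noU; exists a; split=> // b [b0 bN]; apply/esym/eqP.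
apply: contraNT no => ba; apply/existsP; exists b; rewrite ba b0 /=.
by apply/forall_inP => n n1; rewrite (bN n n1).1.
Qed.

(** * Basis expansions and values of characters *)

Lemma twalg_sum (F : fieldType) (N : finMonoid0Type) (c : twisting F N)
    (a : twisted_algebra c) :
  a = \sum_s a s *: twbas c (val s).
Proof.
apply/ffunP => u; rewrite sum_ffunE (bigD1 u) //= twscaleE ffunE eqxx mulr1.
rewrite big1 ?addr0 // => s su; rewrite twscaleE ffunE val_eqE eq_sym (negPf su).
exact: mulr0.
Qed.

Lemma linear_mulZ (F : fieldType) (A B : algType F) (f : {linear A -> B})
    (k l : F) (x y : A) :
  f (x * y) = f x * f y -> f ((k *: x) * (l *: y)) = f (k *: x) * f (l *: y).
Proof.
move=> fxy; rewrite -scalerAl -scalerAr ![f (_ *: _)]linearZ /= fxy.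
by rewrite -scalerAl -scalerAr.
Qed.

Section MCharacter.
Variables (gT : finGroupType) (F : numClosedFieldType) (chi : mcharacter gT F).

Lemma char_valX g k : chi (g ^+ k)%g = chi g ^+ k.
Proof.
by elim: k => [|k IHk]; rewrite ?char_val1 // expgS exprS char_valM IHk.
Qed.

(** Group elements have finite order, so the values are roots of unity. *)
Lemma char_val_conjM g : chi g * (chi g)^* = 1.
Proof.
rewrite -normCK; apply/eqP; rewrite sqrp_eq1 //.
rewrite -(pexpr_eq1 (n := #[g]%g)) // -normrX -char_valX expg_order.
by rewrite char_val1 normr1.
Qed.

Lemma char_val_neq0 g : chi g != 0.
Proof.
by apply: contra_eq_neq (char_val_conjM g) => ->; rewrite mul0r eq_sym oner_eq0.
Qed.

Lemma char_valV g : chi g^-1%g = (chi g)^*.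
Proof.
apply: (mulfI (char_val_neq0 g)).
by rewrite -char_valM mulgV char_val1 char_val_conjM.
Qed.

End MCharacter.

(** * The idempotent of a character and the monoid of orbits *)

Section Component.
Variables (F : numClosedFieldType) (M : finComMonoid0Type).
Variable chi : mcharacter (munit M) F.
Local Notation G := (munit M).
Local Notation e := (e_ chi).

Lemma cbasM (x y : M) : cbas F x * cbas F y = cbas F (x ** y).
Proof.
have [->|x0] := eqVneq x mzero; first by rewrite mmul0 /cbas twbas0 mul0r.
have [->|y0] := eqVneq y mzero; first by rewrite mmulr0 /cbas twbas0 mulr0.
rewrite /cbas twbas_mul //; case: eqP => [->|_]; first by rewrite twbas0.
by rewrite scale1r.
Qed.

Lemma cbas1 : cbas F (mone : M) = 1.
Proof. by []. Qed.

Lemma e_cbas_unit (g : G) (x : M) :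
  e * cbas F (val g ** x) = chi g *: (e * cbas F x).
Proof.
rewrite -cbasM mulrA scalerAl; congr (_ * _).
rewrite /e_ -scalerAl scalerA mulrC -scalerA; congr (_ *: _).
(* Replacing h by h g^-1 absorbs [g] and leaves the factor chi(g). *)
rewrite mulr_suml scaler_sumr (reindex_inj (mulIg g^-1%g)) /=.
apply: eq_bigr => h _; rewrite -scalerAl cbasM scalerA; congr (_ *: cbas F _).
  by rewrite char_valM char_valV rmorphM /= conjCK mulrC.
by rewrite -[LHS]/(val (h * g^-1 * g)%g) mulgKV.
Qed.

(** Each term conj(chi(g)) e g of the expanded factor equals e. *)
Lemma e_idem : e * e = e.
Proof.
rewrite {2}/e_ -scalerAr mulr_sumr.
under eq_bigr => g _.
  rewrite -scalerAr -[val g]mmulr1 e_cbas_unit cbas1 mulr1 scalerA mulrC.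
  rewrite char_val_conjM scale1r; over.
rewrite sumr_const -scaler_nat scalerA mulVf ?scale1r //.
by rewrite pnatr_eq0 -lt0n; apply/card_gt0P; exists 1%g.
Qed.

Lemma e_cbas_zIchi (x : M) : x \in zIchi chi -> e * cbas F x = 0.
Proof.
case/setU1P => [->|]; first by rewrite /cbas twbas0 mulr0.
rewrite inE => /subsetPn[g /GstabP gx]; rewrite inE => g1.
have /eqP := e_cbas_unit g x; rewrite gx -subr_eq0 -{1}[e * _]scale1r -scalerBl.
by rewrite scaler_eq0 subr_eq0 eq_sym (negPf g1) => /eqP.
Qed.

Lemma cbasC (x : M) (a : contracted F M) : a * cbas F x = cbas F x * a.
Proof.
rewrite [a]twalg_sum mulr_suml mulr_sumr; apply: eq_bigr => s _.
by rewrite -scalerAl -scalerAr -/(cbas F _) !cbasM mmulC.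
Qed.

Lemma contractedC (a b : contracted F M) : a * b = b * a.
Proof.
rewrite [a]twalg_sum mulr_suml mulr_sumr; apply: eq_bigr => s _.
by rewrite -scalerAl -scalerAr -/(cbas F _) cbasC.
Qed.


Lemma e_cbasM (x y : M) :
  (e * cbas F x) * (e * cbas F y) = e * cbas F (x ** y).
Proof.
rewrite mulrA -[e * _ * e]mulrA [cbas F x * e]contractedC mulrA e_idem.
by rewrite -mulrA cbasM.
Qed.

Lemma GorbitP (x y : M) :
  reflect (exists g : G, y = val g ** x) (y \in Gorbit x).
Proof. exact: (@uorbitP _ _ (munit_hom M)). Qed.

Lemma zIchi_unit (g : G) (x : M) : (val g ** x \in zIchi chi) = (x \in zIchi chi).
Proof.
apply/idP/idP => [gxI|]; last exact: zIchiM.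
rewrite -[x]mmul1 -[mone]/(val (1%g : G)) -(mulVg g) -[val _]/(val g^-1%g ** val g).
by rewrite -mmulA zIchiM.
Qed.

Lemma GorbM (x y : M) : Gorb chi x ** Gorb chi y = Gorb chi (x ** y).
Proof. by rewrite /Gorb uorb_mul -[_ ** _]/(rees_mul _ _) rees_mulE. Qed.

Lemma Gorb_eqP (x y : M) : x \notin zIchi chi ->
  reflect (exists g : G, x = val g ** y) (Gorb chi x == Gorb chi y).
Proof.
move=> nI; rewrite -val_eqE /= /uorbit; apply: (iffP eqP) => [|[g ->]].
  move/orbit_eqP/uorbitP => [g /(congr1 val)]; rewrite -[_ ** _]/(rees_mul _ _).
  rewrite rees_mulE /= /rees_fun (negPf nI).
  case: ifP => [_ x0|_ ->]; last by exists g.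
  by rewrite x0 zIchi0 in nI.
apply/orbit_eqP/uorbitP; exists g; rewrite -[RHS]/(rees_mul _ _) rees_mulE.
by [].
Qed.

Lemma Gorb_eq0 (x : M) : (Gorb chi x == mzero) = (x \in zIchi chi).
Proof.
apply/eqP/idP => [x0|Ix].
  apply: contraT => nI; have /eqP/(Gorb_eqP mzero nI)[g xE] := x0.
  by move: nI; rewrite xE mmulr0 zIchi0.
by congr uorb; apply/eqP; rewrite rees_pi_eq0.
Qed.

Lemma mpow_Gorb (x : M) k : mpow (Gorb chi x) k = Gorb chi (mpow x k).
Proof. by elim: k => [//|k IHk]; rewrite /= [mpow _ k]IHk GorbM. Qed.

(** All units lie in the orbit of [mone], so a nonidentity orbit comes from a nonunit. *)
Lemma MchiG_nilpotent :
    (forall x : M, ~~ is_munit x -> nilpotent_elt x) ->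
  forall s : MchiG chi, s != mone -> nilpotent_elt s.
Proof.
move=> nilM s s1; have [y sE] := uorb_surj s; subst s.
move: s1; rewrite -[y]rees_pi_val -/(Gorb chi (val y)); move: (val y) => {y}x x1.
have [ux|/nilM[k xk0]] := boolP (is_munit x); last first.
  by exists k; rewrite mpow_Gorb xk0; apply/eqP; rewrite Gorb_eq0 zIchi0.
case/eqP: x1; apply/eqP; rewrite eq_sym; apply/Gorb_eqP; first exact: zIchi1.
exists (Sub x ux : G)^-1%g.
by rewrite -[RHS]/(val ((Sub x ux : G)^-1 * Sub x ux)%g) mulVg.
Qed.

(** * Orbit representatives and the cocycle [cchi] *)

Section Representatives.
Variables (r : nat) (m : 'I_r.+1 -> M).
Hypothesis hm : orbit_reps m.

Lemma orbit_repP (x : M) : x != mzero -> exists g i, x = val (g : G) ** m i.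
Proof.
by case: hm => _ _ mU /mU[i [/uorbitP[g ->] _]]; exists g, i.
Qed.

Lemma orbit_rep_inj (g h : G) i j : val g ** m i = val h ** m j -> i = j.
Proof.
case: hm => _ m0 mU E; have gm0 : val g ** m i != mzero.
  apply/eqP => gm0; case/eqP: (m0 i); rewrite -[m i]mmul1 -[mone]/(val (1%g : G)).
  by rewrite -(mulVg g) -[val _]/(val g^-1%g ** val g) -mmulA gm0 mmulr0.
have [k [_ kU]] := mU _ gm0.
by rewrite -(kU i) -1?(kU j) //; apply/uorbitP; [exists h|exists g].
Qed.

Lemma JchiE i : (i \in Jchi chi m) = (m i \notin zIchi chi).
Proof.
by case: hm => _ m0 _; rewrite !inE negb_or m0 negbK.
Qed.

Lemma chi_ext_rep i : i \in Jchi chi m -> chi_ext chi m (m i) = 1.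
Proof.
rewrite JchiE -{2}[m i]mmul1 -{1}[m i]mmul1 => Ji.
by rewrite (@chi_extE _ _ chi _ _ 1%g) // char_val1.
Qed.

Lemma chi_ext_unit (g : G) (x : M) : x \notin zIchi chi ->
  chi_ext chi m (val g ** x) = chi g * chi_ext chi m x.
Proof.
move=> nI; have x0 : x != mzero by apply: contraNneq nI => ->; exact: zIchi0.
have [h [i xE]] := orbit_repP x0; rewrite xE mmulA -[val g ** val h]/(val (g * h)%g).
rewrite !chi_extE ?char_valM // -?xE // zIchi_unit.
by move: nI; rewrite xE zIchi_unit.
Qed.

Lemma chi_ext_neq0 (x : M) : x \notin zIchi chi -> chi_ext chi m x != 0.
Proof.
move=> nI; have x0 : x != mzero by apply: contraNneq nI => ->; exact: zIchi0.
have [h [i xE]] := orbit_repP x0.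
by rewrite xE chi_extE -?xE // char_val_neq0.
Qed.

Lemma Gorb_rep_inj i j :
  i \in Jchi chi m -> Gorb chi (m i) = Gorb chi (m j) -> i = j.
Proof.
rewrite JchiE => nI /eqP/(Gorb_eqP _ nI)[g]; rewrite -[LHS]mmul1.
exact: (@orbit_rep_inj 1%g).
Qed.

Lemma Gorb_rep_surj (s : MchiG chi) : s != mzero ->
  exists2 i, i \in Jchi chi m & s = Gorb chi (m i).
Proof.
have [y ->] := uorb_surj s; rewrite -[y]rees_pi_val -/(Gorb chi (val y)).
move: (val y) => {y s}x; rewrite Gorb_eq0 => nI.
have x0 : x != mzero by apply: contraNneq nI => ->; exact: zIchi0.
have [g [i xE]] := orbit_repP x0; exists i.
  by rewrite JchiE -(zIchi_unit g) -xE.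
by apply/eqP/Gorb_eqP => //; exists g.
Qed.

Lemma notin_zIchiM (x y : M) :
  x ** y \notin zIchi chi -> x \notin zIchi chi /\ y \notin zIchi chi.
Proof.
move=> nI; split; apply: contra nI; last exact: zIchiM.
by rewrite mmulC; exact: zIchiM.
Qed.

Lemma cchi_rep i j : i \in Jchi chi m -> j \in Jchi chi m ->
  cchi m (Gorb chi (m i)) (Gorb chi (m j)) = chi_ext chi m (m i ** m j).
Proof.
move=> Ji Jj; rewrite /cchi; case: pickP => [[i' j'] /=|/(_ (i, j))]; last first.
  by rewrite /= Ji Jj !eqxx.
by case/and4P=> _ _ /eqP/(Gorb_rep_inj Ji) <- /eqP/(Gorb_rep_inj Jj) <-.
Qed.

(* Hence c_chi is a cocycle, being a coboundary on the elements outside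
   I_chi U {z}. *)
Lemma chi_extM (x y : M) : x ** y \notin zIchi chi ->
  chi_ext chi m (x ** y) =
  chi_ext chi m x * chi_ext chi m y * cchi m (Gorb chi x) (Gorb chi y).
Proof.
move=> nI; have [xI yI] := notin_zIchiM nI.
have x0 : x != mzero by apply: contraNneq xI => ->; exact: zIchi0.
have y0 : y != mzero by apply: contraNneq yI => ->; exact: zIchi0.
have [g [i xE]] := orbit_repP x0; have [h [j yE]] := orbit_repP y0.
have Ji : i \in Jchi chi m by rewrite JchiE -(zIchi_unit g) -xE.
have Jj : j \in Jchi chi m by rewrite JchiE -(zIchi_unit h) -yE.
have -> : Gorb chi x = Gorb chi (m i) by apply/eqP/Gorb_eqP => //; exists g.
have -> : Gorb chi y = Gorb chi (m j) by apply/eqP/Gorb_eqP => //; exists h.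
have xyE : x ** y = val (g * h)%g ** (m i ** m j).
  rewrite xE yE -[val (g * h)%g]/(val g ** val h) -!mmulA; congr (_ ** _).
  by rewrite !mmulA [m i ** _]mmulC.
rewrite cchi_rep // xyE chi_ext_unit; last by rewrite -(zIchi_unit (g * h)%g) -xyE.
by rewrite xE yE !chi_extE ?char_valM -?xE -?yE.
Qed.

Lemma cchi_twisting : is_twisting (@cchi _ _ chi _ m).
Proof.
have [m1 _ _] := hm.
split=> [s t st0|s s0|s t u stu0].
- have [i Ji sE] := Gorb_rep_surj (neq0_mull st0).
  have [j Jj tE] := Gorb_rep_surj (neq0_mulr st0).
  rewrite sE tE cchi_rep // chi_ext_neq0 //.
  by rewrite -Gorb_eq0 -GorbM -sE -tE.
- have [i Ji ->] := Gorb_rep_surj s0.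
  have J0 : ord0 \in Jchi chi m by rewrite JchiE m1 zIchi1.
  rewrite -[mone]/(Gorb chi mone) -m1 !cchi_rep //.
  by rewrite m1 mmul1 mmulr1 chi_ext_rep.
have [i Ji sE] := Gorb_rep_surj (neq0_mull (neq0_mull stu0)).
have [j Jj tE] := Gorb_rep_surj (neq0_mulr (neq0_mull stu0)).
have [k Jk uE] := Gorb_rep_surj (neq0_mulr stu0).
move: stu0; rewrite sE tE uE !GorbM Gorb_eq0 => nI.
have [nIij _] := notin_zIchiM nI.
have nI' := nI; rewrite -mmulA in nI'; have [_ nIjk] := notin_zIchiM nI'.
(* Expanding chi(m_i m_j m_k) along both bracketings gives the cocycle identity, since chi is 1 on
   representatives. *)
have := chi_extM nI; rewrite (chi_extM nIij) -mmulA (chi_extM nI') (chi_extM nIjk).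
by rewrite !chi_ext_rep // !mul1r !mulr1 => <-.
Qed.

Lemma e_cbas_rep (x : M) i : x \notin zIchi chi -> Gorb chi x = Gorb chi (m i) ->
  e * cbas F x = chi_ext chi m x *: (e * cbas F (m i)).
Proof.
move=> nI /eqP/(Gorb_eqP _ nI)[g xE]; rewrite xE e_cbas_unit chi_extE //.
by rewrite -xE.
Qed.

(** The g in G are grouped by x = g m_i: each fibre is a coset of the stabilizer, on which chi(g) is
    constant, and orbit-stabilizer turns 1/|G| into the stated factor. *)
Lemma e_cbas_sum i : i \in Jchi chi m ->
  e * cbas F (m i) = #|Gorbit (m i)|%:R^-1 *:
    \sum_(x in Gorbit (m i)) (chi_ext chi m x)^* *: cbas F x.
Proof.
rewrite JchiE => nI; rewrite /e_ -scalerAl mulr_suml.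
pose H := 'C_[set: G][m i | uact (munit_hom M)]%g.
have HG : (#|Gorbit (m i)| * #|H|)%N = #|{: G}|.
  rewrite -[#|{: G}|]cardsT.
  exact: (card_orbit_stab (uact (munit_hom M)) [group of setT] (m i)).
rewrite -HG natrM invfM -scalerA; congr (_ *: _).
rewrite (partition_big (fun g : G => val g ** m i) (mem (Gorbit (m i)))) /=;
  last first.
  by move=> g _; apply/uorbitP; exists g.
rewrite scaler_sumr; apply: eq_bigr => x /uorbitP[g xE].
transitivity (#|H|%:R^-1 *: (\sum_(h in amove (uact (munit_hom M)) [set: G] (m i) x)
   (chi_ext chi m x)^* *: cbas F x)).
  congr (_ *: _); apply: eq_big => [h|h /eqP <-]; first by rewrite !inE.
  by rewrite -scalerAl cbasM chi_extE // zIchi_unit.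
rewrite sumr_const xE -[_ ** m i]/(uact (munit_hom M) (m i) g) amove_act ?inE //.
rewrite card_rcoset -/H -scaler_nat !scalerA mulrA mulVf ?mul1r //.
by rewrite pnatr_eq0 -lt0n cardG_gt0.
Qed.

Lemma card_Jchi : #|Jchi chi m| = #|{: nonzero (MchiG chi)}|.
Proof.
rewrite card_sig -(@card_in_imset _ _ (fun i => Gorb chi (m i))) => [|i j Ji _].
  apply: eq_card => s; rewrite [RHS]inE; apply/imsetP/idP => [[j]|/Gorb_rep_surj[j]].
    by rewrite JchiE => nI ->; rewrite Gorb_eq0.
  by exists j.
exact: Gorb_rep_inj.
Qed.

(** Orbits are disjoint, so of the representatives only [m i] occurs in e m_i. Evaluation at
    representatives thus separates the e m_i. *)
Lemma e_cbas_coef i j (m0 : m j != mzero) : i \in Jchi chi m -> j \in Jchi chi m ->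
  (e * cbas F (m i)) (Sub (m j) m0) = (i == j)%:R / #|Gorbit (m i)|%:R.
Proof.
move=> Ji Jj; rewrite e_cbas_sum // twscaleE mulrC; congr (_ / _).
rewrite sum_ffunE.
have [ij|ij] := eqVneq i j.
  rewrite (bigD1 (m j)) /=; last first.
    by rewrite ij; apply/uorbitP; exists 1%g; rewrite uhom1 mmul1.
  rewrite twscaleE ffunE /= eqxx chi_ext_rep // rmorph1 mulr1 big1 ?addr0 //.
  move=> x /andP[_ xj]; rewrite twscaleE ffunE /= eq_sym (negPf xj) mulr0 //.
rewrite big1 // => x /uorbitP[g ->]; rewrite twscaleE ffunE /=.
case: eqP => [|_]; last by rewrite mulr0.
rewrite -[m j]mmul1 => /esym /(@orbit_rep_inj g 1%g) /eqP.
by rewrite (negPf ij).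
Qed.

(** * The isomorphism with the twisted algebra of orbits *)

Section CornerMap.
(** Agreement with [cchi] is asked only on nonzero products, so that [c] may also be the trivial
    twisting. *)
Variable c : twisting F (MchiG chi).
Hypothesis c_cchi : forall s t, s ** t != mzero -> c s t = cchi m s t.

Definition orbit_rep (s : MchiG chi) : 'I_r.+1 :=
  odflt ord0 [pick i in Jchi chi m | Gorb chi (m i) == s].

Lemma orbit_repK i : i \in Jchi chi m -> orbit_rep (Gorb chi (m i)) = i.
Proof.
move=> Ji; rewrite /orbit_rep; case: pickP => [j /andP[Jj /eqP/Gorb_rep_inj->]|] //.
by move/(_ i); rewrite Ji eqxx.
Qed.

Definition corner_fun (a : twisted_algebra c) : contracted F M :=
  \sum_s a s *: (e * cbas F (m (orbit_rep (val s)))).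

Fact corner_fun_is_linear : linear corner_fun.
Proof.
move=> k a b; rewrite /corner_fun scaler_sumr -big_split; apply: eq_bigr => s _.
by rewrite ffunE twscaleE scalerDl scalerA.
Qed.

HB.instance Definition _ := GRing.isLinear.Build F (twisted_algebra c)
  (contracted F M) _ corner_fun corner_fun_is_linear.

Definition corner_map : 'Hom(twisted_algebra c, contracted F M) :=
  linfun corner_fun.

Lemma corner_map_bas i : i \in Jchi chi m ->
  corner_map (twbas c (Gorb chi (m i))) = e * cbas F (m i).
Proof.
move=> Ji; rewrite lfunE /= /corner_fun.
have s0 : Gorb chi (m i) != mzero by rewrite Gorb_eq0 -JchiE.
rewrite (bigD1 (Sub (Gorb chi (m i)) s0 : nonzero (MchiG chi))) //= ffunE /= eqxx.
rewrite scale1r orbit_repK // big1 ?addr0 //.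
by move=> s; rewrite -val_eqE ffunE /= => /negPf ->; rewrite scale0r.
Qed.

Lemma corner_map_bas_mul (s t : MchiG chi) : s != mzero -> t != mzero ->
  corner_map (twbas c s * twbas c t) =
  corner_map (twbas c s) * corner_map (twbas c t).
Proof.
move=> s0 t0; rewrite (twbas_mul c s0 t0).
have [i Ji ->] := Gorb_rep_surj s0; have [j Jj ->] := Gorb_rep_surj t0.
transitivity ((e * cbas F (m i)) * (e * cbas F (m j))); last first.
  by congr (_ * _); apply/esym/corner_map_bas.
rewrite e_cbasM GorbM Gorb_eq0; case: ifPn => [/e_cbas_zIchi->|nI]; first exact: linear0.
have st0 : Gorb chi (m i ** m j) != mzero by rewrite Gorb_eq0.
have [k Jk kE] := Gorb_rep_surj st0.
rewrite linearZ /= c_cchi ?GorbM // cchi_rep // (e_cbas_rep nI kE) kE.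
by rewrite corner_map_bas.
Qed.

Lemma corner_map_mul : {morph corner_map : a b / a * b}.
Proof.
move=> a b; rewrite [a]twalg_sum [b]twalg_sum mulr_suml !linear_sum mulr_suml /=.
apply: eq_bigr => s _; rewrite !mulr_sumr !linear_sum; apply: eq_bigr => t _ /=.
apply: linear_mulZ; apply: corner_map_bas_mul; [exact: (valP s)|exact: (valP t)].
Qed.

Lemma lker_corner_map : lker corner_map = 0%VS.
Proof.
apply/eqP; rewrite -subv0; apply/subvP => a; rewrite memv_ker memv0 => /eqP fa0.
apply/eqP/ffunP => s; rewrite [RHS]ffunE.
have [j Jj sE] := Gorb_rep_surj (valP s); have [_ m0 _] := hm.
(* Evaluated at [m j], only the term of [s] survives, with factor 1/|G m_j|. *)
have /ffunP/(_ (Sub (m j) (m0 j))) := fa0; rewrite lfunE /= /corner_fun.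
rewrite sum_ffunE [RHS]ffunE (bigD1 s) //= big1 ?addr0 => [|t ts].
  rewrite twscaleE sE orbit_repK // e_cbas_coef // eqxx mul1r => /eqP.
  rewrite mulf_eq0 invr_eq0 pnatr_eq0 => /orP[/eqP //|].
  rewrite -leqn0 leqNgt => /card_gt0P[]; exists (m j).
  by apply/uorbitP; exists 1%g; rewrite uhom1 mmul1.
have [i Ji tE] := Gorb_rep_surj (valP t).
rewrite twscaleE tE orbit_repK // e_cbas_coef //.
case: eqP => [ij|_]; last by rewrite mul0r mulr0.
by case/eqP: ts; apply: val_inj; rewrite sE tE ij.
Qed.

Lemma e_cbas_span (U : {vspace contracted F M}) :
    (forall i, i \in Jchi chi m -> e * cbas F (m i) \in U) ->
  (<[e]> * fullv <= U)%VS.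
Proof.
move=> Um; apply/prodvP => _ a /vlineP[k ->] _; rewrite -scalerAl; apply: memvZ.
rewrite [a]twalg_sum mulr_sumr; apply: memv_suml => s _.
rewrite -scalerAr -/(cbas F _); apply: memvZ.
have [/e_cbas_zIchi->|nI] := boolP (val s \in zIchi chi); first exact: mem0v.
have s0 : Gorb chi (val s) != mzero by rewrite Gorb_eq0.
have [i Ji sE] := Gorb_rep_surj s0.
by rewrite (e_cbas_rep nI sE) memvZ ?Um.
Qed.

Lemma limg_corner_map : limg corner_map = (<[e]> * fullv)%VS.
Proof.
apply/eqP; rewrite eqEsubv; apply/andP; split.
  apply/subvP => _ /memv_imgP[a _ ->]; rewrite lfunE /=.
  by apply: memv_suml => s _; rewrite memvZ ?memv_mul ?memv_line ?memvf.
apply: e_cbas_span => i Ji; rewrite -corner_map_bas //; apply: memv_img.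
exact: memvf.
Qed.

Lemma corner_map_iso : corner_iso e (<[e]> * fullv)%VS (twisted_algebra c).
Proof.
exists corner_map; split; [exact: lker_corner_map|exact: limg_corner_map| |].
  have [m1 _ _] := hm; have J0 : ord0 \in Jchi chi m by rewrite JchiE m1 zIchi1.
  rewrite -[1]/(twbas c (Gorb chi mone)) -m1 corner_map_bas // m1 cbas1.
  exact: mulr1.
exact: corner_map_mul.
Qed.

Lemma dimv_e : \dim (<[e]> * {: contracted F M})%VS = #|Jchi chi m|.
Proof.
rewrite -limg_corner_map limg_dim_eq ?lker_corner_map ?capv0 // card_Jchi dimvf.
exact: muln1.
Qed.

End CornerMap.

(** The e m_i span, and their number is the dimension by injectivity of [corner_map]. *)
Lemma e_cbas_basis :
  basis_of (<[e]> * {: contracted F M})%VS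
    [seq e * cbas F (m i) | i in Jchi chi m].
Proof.
rewrite basisEdim size_image (@dimv_e (Twisting cchi_twisting)) // leqnn andbT.
by apply: e_cbas_span => i Ji; apply/memv_span/image_f.
Qed.

Lemma e_corner :
  (<[e]> * {: contracted F M} = <[e]> * {: contracted F M} * <[e]>)%VS.
Proof.
apply/eqP; rewrite eqEsubv; apply/andP; split; last first.
  by rewrite -prodvA prodvSr ?subvf.
apply/prodvP => _ a /vlineP[k ->] _; rewrite -scalerAl memvZ //.
have -> : e * a = e * a * e by rewrite -mulrA [a * e]contractedC mulrA e_idem.
by rewrite memv_mul ?memv_line // memv_mul ?memv_line ?memvf.
Qed.

Lemma det_Achi (k : 'I_r.+1) : k \in Jchi chi m ->
  \det (form_mx (@cchi _ _ chi _ m) (fun s => (s == Gorb chi (m k))%:R)) =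
  \det (Achi chi m k).
Proof.
move=> Jk.
have J0 (a : 'I_#|Jchi chi m|) : Gorb chi (m (enum_val a)) != mzero.
  by rewrite Gorb_eq0 -JchiE enum_valP.
pose h a := enum_rank (Sub (Gorb chi (m (enum_val a))) (J0 a) : nonzero (MchiG chi)).
have hE a : nzval (h a) = Gorb chi (m (enum_val a)) by rewrite /nzval enum_rankK.
have h_inj : injective h.
  move=> a b /(congr1 (@nzval _)); rewrite !hE => /Gorb_rep_inj; rewrite enum_valP.
  by move=> /(_ isT)/enum_val_inj.
have h_bij : bijective h by apply: inj_card_bij => //; rewrite !card_ord card_Jchi.
rewrite -(det_mxsub_bij _ h_bij); congr determinant; apply/matrixP => a b.
rewrite !mxE /= !hE GorbM Gorb_eq0; set x := _ ** _.
have Jk0 : m k \notin zIchi chi by rewrite -JchiE.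
(* For [x] in the ideal the form has entry 0, and so has [Achi], as the orbit of [m k] avoids the
   ideal. *)
case: ifPn => [xI|nI].
  case: ifP => // /GorbitP[g xE]; case/negP: Jk0.
  by rewrite -(zIchi_unit g) -xE.
rewrite cchi_rep ?enum_valP // -/x.
have -> : (x \in Gorbit (m k)) = (Gorb chi x == Gorb chi (m k)).
  by apply/GorbitP/(Gorb_eqP _ nI).
by case: eqP; rewrite ?mulr1 ?mulr0.
Qed.

End Representatives.
End Component.

Theorem proposition6p9 (R : realType) (M : finComMonoid0Type)
    (hnil : forall x : M, ~~ is_munit x -> nilpotent_elt x)
    (r : nat) (m : 'I_r.+1 -> M) (hm : orbit_reps m)
    (chi : mcharacter (munit M) R[i]) :
  (* (1) *)
  [/\ (<[e_ chi]> * {: contracted R[i] M} =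
         <[e_ chi]> * {: contracted R[i] M} * <[e_ chi]>)%VS,
      forall i, i \in Jchi chi m ->
        e_ chi * cbas R[i] (m i) =
          #|Gorbit (m i)|%:R^-1 *:
            \sum_(x in Gorbit (m i)) (chi_ext chi m x)^* *: cbas R[i] x
    & basis_of (<[e_ chi]> * {: contracted R[i] M})%VS
        [seq e_ chi * cbas R[i] (m i) | i in Jchi chi m]]
  /\
  (* (2) *)
  [/\ forall i j, m i ** m j \notin zIchi chi ->
        cchi m (Gorb chi (m i)) (Gorb chi (m j)) = chi_ext chi m (m i ** m j),
      exists hc : is_twisting (@cchi _ _ chi _ m),
        corner_iso (e_ chi) (<[e_ chi]> * {: contracted R[i] M})%VS
          (twisted_algebra (Twisting hc))
    & (forall i j, m i ** m j \notin zIchi chi -> m i ** m j = m (fidx m i j)) ->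
        corner_iso (e_ chi) (<[e_ chi]> * {: contracted R[i] M})%VS
          (twisted_algebra (trivial_twisting R[i] (MchiG chi)))]
  /\
  (* (3) *)
  ((~ (exists! a : MchiG chi, annihilating a)) ->
     paratrophic_det (@cchi _ _ chi _ m) = 0)
  /\
  (forall a : MchiG chi, unique (@annihilating _) a ->
     exists k : 'I_r.+1,
       [/\ k \in Jchi chi m, Gorb chi (m k) = a
         & paratrophic_det (@cchi _ _ chi _ m) =
             (\det (Achi chi m k))%:MP *
               pvar R[i] (Gorb chi (m k)) ^+ (#|{: MchiG chi}| - 1)]).
Proof.
have nilQ := @MchiG_nilpotent _ _ chi hnil.
have hc := @cchi_twisting _ _ chi _ _ hm.
split; [split|split; [split|split]].
- exact: e_corner.
- by move=> i; exact: e_cbas_sum.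
- exact: e_cbas_basis.
- move=> i j nI; have [nIi nIj] := notin_zIchiM nI.
  by apply: cchi_rep; rewrite ?JchiE.
- by exists hc; apply: (corner_map_iso (c := Twisting hc) hm).
(* A product that is itself a representative has chi value 1, so [cchi] is trivial on nonzero
   products. *)
- move=> mf; apply: (corner_map_iso hm) => s t st0 /=.
  have [i Ji sE] := Gorb_rep_surj hm (neq0_mull st0).
  have [j Jj tE] := Gorb_rep_surj hm (neq0_mulr st0).
  have nI : m i ** m j \notin zIchi chi by rewrite -Gorb_eq0 -GorbM -sE -tE.
  by rewrite sE tE cchi_rep // mf // chi_ext_rep ?JchiE // -mf.
- exact: (paratrophic_det_eq0 (Twisting hc) nilQ).
move=> a [aN _]; have [k Jk aE] := Gorb_rep_surj hm aN.1.
exists k; split=> //.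
have <- : #|{: nonzero (MchiG chi)}| = (#|{: MchiG chi}| - 1)%N.
  by rewrite card_sig cardC1 subn1.
rewrite -(det_Achi hm Jk) -aE.
exact: (paratrophic_detE nilQ (Twisting hc) aN).
Qed.
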